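(* Let $W_\alpha$ be a contractive weighted shift (i.e. $\|W_\alpha\|\le1$) whose weight sequence $\alpha$ has a limit (for example, if $W_\alpha$ is hyponormal), and fix $m\in\mathbb{N}$. Assume that for all $k\ge m$, $W_\alpha$ is $(k,2m)$-PD or $(k,2m)$-CPD. Then $W_\alpha$ is subnormal.
   Context: Weighted shifts: given a bounded sequence $\alpha=(\alpha_n)_{n=0}^\infty$ of positive real numbers, $W_\alpha$ is the bounded operator on $\ell^2(\mathbb{N}_0)$ with $W_\alpha e_n=\alpha_n e_{n+1}$. Its moment sequence $\gamma$ is $\gamma_0:=1$, $\gamma_n:=\prod_{j=0}^{n-1}\alpha_j^2$ for $n\ge1$. An operator is subnormal if it is the restriction of a normal operator to a closed invariant subspace; an operator $T$ is hyponormal if $T^*T\ge TT^*$ (for $W_\alpha$: $\alpha_n\le\alpha_{n+1}$ for all $n$). For a real sequence $a$, $(\nabla a)_n:=a_n-a_{n+1}$, $\nabla^0 a:=a$, $\nabla^{n}:=\nabla\circ\nabla^{n-1}$. For integers $i,r\ge 0$, $M_a(i,r):=(a_{i+s+t})_{s,t=0}^{r}$, the $(r+1)\times(r+1)$ Hankel matrix. ''Positive definite'' means positive semi-definite. A Hermitian matrix $A=(a_{st})$ is conditionally positive definite (CPD) if $\sum_{s,t}a_{st}\bar c_s c_t\ge 0$ for all complex vectors $c$ with $\sum_s c_s=0$. For integers $k\ge1$ and $0\le m\le k$, $W_\alpha$ is $(k,2m)$-PD (resp. $(k,2m)$-CPD) if, for every $i\ge 0$, the matrix $M_{\nabla^{2m}(\gamma)}(i,k-m)$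 is positive definite (resp. CPD). *)

(* Defs.v *)
From HB Require Import structures.
From mathcomp Require Import all_boot all_order all_algebra sesquilinear.
From mathcomp Require Import all_classical all_reals all_analysis.
From mathcomp Require Import complex ring lra.

Set Implicit Arguments.
Unset Strict Implicit.
Unset Printing Implicit Defensive.

Import Order.TTheory GRing.Theory Num.Theory.
Import numFieldNormedType.Exports.

Local Open Scope classical_set_scope.
Local Open Scope ring_scope.

Section complex_topology.
Variable R : realType.

(* As for the structures handled by numFieldNormedType, R[i] is made to inherit
   the topology and norm of R[i]^o. *)
HB.instance Definition _ := NormedModule.copy R[i] R[i]^o.

Lemma Re_norm (z : R[i]) : `|complex.Re z| <= complex.Re `|z|.
Proof. by have := normc_ge_Re z; rewrite lecE => /andP[]. Qed.

Lemma Im_norm (z : R[i]) : `|complex.Im z| <= complex.Re `|z|.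
Proof.
rewrite normc_def /= -sqrtr_sqr ler_wsqrtr// lerDr; exact: sqr_ge0.
Qed.

Lemma Re_gt0 (e : R[i]) : 0 < e -> e = (complex.Re e)%:C%C /\ 0 < complex.Re e.
Proof.
by case: e => a b; rewrite ltcE /= => /andP[/eqP-> ->].
Qed.

Lemma Re_normE (V : normedZmodType R[i]) (x : V) :
  `|x| = (complex.Re `|x|)%:C%C.
Proof. by rewrite RRe_real// normr_real. Qed.

Lemma Re_norm_ge0 (V : normedZmodType R[i]) (x : V) : 0 <= complex.Re `|x|.
Proof. by rewrite -ler0c -Re_normE. Qed.

Lemma norm_realC (r : R) : `|r%:C%C : R[i]| = `|r|%:C%C.
Proof. by rewrite normc_def /= expr0n /= addr0 sqrtr_sqr. Qed.

Lemma Re_norm_le (z : R[i]) :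
  complex.Re `|z| <= `|complex.Re z| + `|complex.Im z|.
Proof.
rewrite -lecR -Re_normE [in leLHS](complexE z) (le_trans (ler_normD _ _))//.
rewrite normrM rmorphD /= !norm_realC lerD//.
by rewrite [X in X * _]normc_def /= expr0n /= add0r expr1n sqrtr1 mul1r.
Qed.

Section cvg.
Context {T : Type} {F : set_system T} {FF : Filter F}.
Implicit Types (f : T -> R[i]) (l : R[i]).

Lemma cvg_Re f l : f @ F --> l -> complex.Re (f x) @[x --> F] --> complex.Re l.
Proof.
move=> /cvgrPdist_lt fl; apply/cvgrPdist_lt => e e0.
have := fl e%:C%C; rewrite ltcR => /(_ e0); apply: filterS => x.
rewrite ltcE => /andP[_]; apply: le_lt_trans.
by rewrite -(raddfB (@complex.Re R : {additive Rcomplex R -> R})) Re_norm.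
Qed.

Lemma cvg_Im f l : f @ F --> l -> complex.Im (f x) @[x --> F] --> complex.Im l.
Proof.
move=> /cvgrPdist_lt fl; apply/cvgrPdist_lt => e e0.
have := fl e%:C%C; rewrite ltcR => /(_ e0); apply: filterS => x.
rewrite ltcE => /andP[_]; apply: le_lt_trans.
by rewrite -(raddfB (@complex.Im R : {additive Rcomplex R -> R})) Im_norm.
Qed.

Lemma cvg_complex f l :
  complex.Re (f x) @[x --> F] --> complex.Re l ->
  complex.Im (f x) @[x --> F] --> complex.Im l -> f @ F --> l.
Proof.
move=> /cvgrPdist_lt fa /cvgrPdist_lt fb; apply/cvgrPdist_lt => e /Re_gt0[-> e0].
have e20 : 0 < complex.Re e / 2 by rewrite divr_gt0.
near=> x.
rewrite Re_normE ltcR (le_lt_trans (Re_norm_le _))// [ltRHS]splitr.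
rewrite (raddfB (@complex.Re R : {additive Rcomplex R -> R})).
rewrite (raddfB (@complex.Im R : {additive Rcomplex R -> R})).
by rewrite ltrD//; near: x; [exact: fa|exact: fb].
Unshelve. all: by end_near. Qed.

Lemma cvg_conjc f l : f @ F --> l -> Num.conj (f x) @[x --> F] --> Num.conj l.
Proof.
have ReJ (z : R[i]) : complex.Re (Num.conj z) = complex.Re z by case: z.
have ImJ (z : R[i]) : complex.Im (Num.conj z) = - complex.Im z by case: z.
move=> fl; apply: cvg_complex.
  by under eq_fun do rewrite ReJ; rewrite ReJ; exact: cvg_Re.
by under eq_fun do rewrite ImJ; rewrite ImJ; apply: cvgN; exact: cvg_Im.
Qed.

End cvg.

Lemma complex_is_complete (F : set_system R[i]) :
  ProperFilter F -> cauchy F -> cvg F.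
Proof.
move=> FF /cauchy_ballP Fc.
have cvg_part (f : {additive Rcomplex R -> R}) :
    (forall z : R[i], `|f z| <= complex.Re `|z|) -> cvg (f @ F).
  move=> f1; apply: (@cauchy_cvg R); apply/cauchy_ballP => e e0.
  have := Fc e%:C%C; rewrite ltcR => /(_ e0).
  case=> -[A B] /= [FA FB] AB.
  exists (f @` A, f @` B) => /=.
    by split; [apply: filterS FA|apply: filterS FB] => z Az; exists z.
  case=> _ _ [[x Ax <-] [y By <-]] /=.
  have := AB (x, y) (conj Ax By); rewrite /= /ball /= -raddfB ltcE => /andP[_].
  exact: le_lt_trans.
have /cvg_ex[/= a Fa] := cvg_part (@complex.Re R : {additive Rcomplex R -> R}) Re_norm.
have /cvg_ex[/= b Fb] := cvg_part (@complex.Im R : {additive Rcomplex R -> R}) Im_norm.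
by apply/cvg_ex; exists (a +i* b)%C; apply: cvg_complex.
Qed.

HB.instance Definition _ := Uniform_isComplete.Build R[i] complex_is_complete.

Lemma series_le_cvgC (u : nat -> R[i]) (v : nat -> R) :
  (forall n, complex.Re `|u n| <= v n) -> cvgn (series v) -> cvgn (series u).
Proof.
move=> uv vc.
have part (f : {additive Rcomplex R -> R}) :
    (forall z : R[i], `|f z| <= complex.Re `|z|) ->
    cvgn (fun n => f (series u n)).
  move=> f1.
  have -> : (fun n => f (series u n)) = series (fun n => f (u n)).
    by apply/funext => n; rewrite /series /= raddf_sum.
  apply: normed_cvg; apply: series_le_cvg vc => n //=.
    exact: le_trans (Re_norm_ge0 _) (uv _).
  exact: le_trans (f1 _) (uv _).
have /cvg_ex[/= a Fa] := part (@complex.Re R : {additive Rcomplex R -> R}) Re_norm.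
have /cvg_ex[/= b Fb] := part (@complex.Im R : {additive Rcomplex R -> R}) Im_norm.
by apply/cvg_ex; exists (a +i* b)%C; apply: cvg_complex.
Qed.

End complex_topology.

(* The norm of a normed module over R[i] takes its values in R[i] (where
   0 <= z means that z is a nonnegative real); inner products are linear in the
   first argument. *)
HB.mixin Record NormedModule_hasInner (R : realType) H & NormedModule R[i] H := {
  inner : {dot H for @Num.conj R[i]};
  inner_norm : forall x, inner x x = `|x| ^+ 2
}.

#[short(type="preHilbertType")]
HB.structure Definition PreHilbert (R : realType) :=
  {H of NormedModule R[i] H & NormedModule_hasInner R H}.

#[short(type="hilbertType")]
HB.structure Definition Hilbert (R : realType) :=
  {H of PreHilbert R H & Complete H}.

Section dot_norm.
Variables (C : numClosedFieldType) (U : lmodType C).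
Variable f : {dot U for @Num.conj C}.

Definition dot_norm (x : U) := sqrtC (f x x).

Lemma dot_norm_ge0 x : 0 <= dot_norm x.
Proof. by rewrite sqrtC_ge0 dnorm_ge0. Qed.

Lemma dot_normK x : dot_norm x ^+ 2 = f x x.
Proof. exact: sqrtCK. Qed.

Lemma dot_normZ a x : dot_norm (a *: x) = `|a| * dot_norm x.
Proof.
by rewrite /dot_norm dnormZ sqrtCM ?nnegrE ?exprn_ge0 ?dnorm_ge0// sqrCK.
Qed.

Lemma dot_norm_eq0 x : dot_norm x = 0 -> x = 0.
Proof. by move=> /eqP; rewrite sqrtC_eq0 dnorm_eq0 => /eqP. Qed.

Lemma dot_CauchySchwarz x y : `|f x y| <= dot_norm x * dot_norm y.
Proof.
have [->|y0] := eqVneq y 0.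
  by rewrite linear0r normr0 mulr_ge0 ?dot_norm_ge0.
have fy0 : 0 < f y y by rewrite dnorm_gt0.
rewrite -ler_sqr ?nnegrE ?mulr_ge0 ?dot_norm_ge0// exprMn !dot_normK.
have := dnorm_ge0 f (x - (f x y / f y y) *: y).
rewrite dnormB dnormZ linearZr_LR /=.
have fyyJ : Num.conj (f y y) = f y y by rewrite geC0_conj// ltW.
rewrite rmorphM /= fmorphV /= fyyJ.
set a := f x y.
rewrite rmorphM /= rmorphM /= conjCK fmorphV /= fyyJ.
have -> : `|a / f y y| ^+ 2 * f y y = `|a| ^+ 2 / f y y.
  rewrite normrM normfV (gtr0_norm fy0) exprMn -mulrA expr2; congr (_ * _).
  by rewrite -mulrA mulVf ?mulr1// gt_eqF.
have -> : a^* / f y y * a = `|a| ^+ 2 / f y y by rewrite mulrAC -normCKC.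
have -> : a / f y y * a^* = `|a| ^+ 2 / f y y by rewrite mulrAC -normCK.
by rewrite opprD addrA addrK subr_ge0 ler_pdivrMr.
Qed.

Lemma dot_norm_triangle x y : dot_norm (x + y) <= dot_norm x + dot_norm y.
Proof.
rewrite -ler_sqr ?nnegrE ?addr_ge0 ?dot_norm_ge0//.
rewrite dot_normK dnormD sqrrD !dot_normK [leRHS]addrAC lerD2l.
set d := f x y.
have dr : d + d^* \is Num.real.
  by rewrite CrealE rmorphD /= conjCK addrC.
rewrite (le_trans (real_ler_norm dr))// (le_trans (ler_normD _ _))//.
by rewrite norm_conjC -mulr2n lerMn2r dot_CauchySchwarz orbT.
Qed.

End dot_norm.

HB.factory Record Lmodule_hasInner (R : realType) H & GRing.Lmodule R[i] H := {
  dot : {dot H for @Num.conj R[i]}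
}.

HB.builders Context (R : realType) H & Lmodule_hasInner R H.

HB.instance Definition _ := Lmodule_isNormed.Build R[i] H
  (dot_norm_triangle dot) (dot_normZ dot) (@dot_norm_eq0 _ _ dot).

HB.instance Definition _ := NormedModule_hasInner.Build R H
  (fun x => esym (dot_normK dot x)).

HB.end.

Section ell2.
Variable R : realType.
Implicit Types (x y : nat -> R[i]).

Definition square_summable : {pred nat -> R[i]} :=
  fun x => `[< cvgn (series (fun n => `|x n| ^+ 2)) >].

Let sq x n : R := complex.Re `|x n| ^+ 2.

Let sq_ge0 x n : 0 <= sq x n. Proof. exact: sqr_ge0. Qed.

Let sqC x n : (sq x n)%:C%C = `|x n| ^+ 2.
Proof. by rewrite [in RHS]Re_normE /sq; exact: rmorphXn. Qed.

Let sqE x : series (fun n => `|x n| ^+ 2) = fun n => (series (sq x) n)%:C%C.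
Proof.
apply/funext => n; rewrite /series /= rmorph_sum /=.
by apply: eq_bigr => i _; rewrite sqC.
Qed.

Lemma cvg_realC (u : nat -> R) (l : R) :
  u @ \oo --> l -> (u n)%:C%C @[n --> \oo] --> l%:C%C.
Proof. by move=> ul; apply: cvg_complex => //=; exact: cvg_cst. Qed.

Lemma square_summableE x :
  (x \in square_summable) = `[< cvgn (series (sq x)) >].
Proof.
rewrite unfold_in /square_summable sqE; apply/asboolP/asboolP.
- by move=> /cvg_ex[/= l /cvg_Re/= xl]; apply/cvg_ex; eexists; exact: xl.
- by move=> /cvg_ex[/= l /cvg_realC xl]; apply/cvg_ex; eexists; exact: xl.
Qed.

Lemma square_summable_le x M :
  (forall n, series (fun n => `|x n| ^+ 2) n <= M) -> x \in square_summable.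
Proof.
move=> xM; rewrite square_summableE; apply/asboolP.
apply: nondecreasing_is_cvgn; first exact: nondecreasing_series.
exists (complex.Re M) => _ [n _ <-].
by have := xM n; rewrite sqE lecE => /andP[].
Qed.

Lemma square_summable_dom x y (a : R) :
  (forall n, sq x n <= a * sq y n) ->
  y \in square_summable -> x \in square_summable.
Proof.
move=> xy; rewrite !square_summableE => /asboolP yc; apply/asboolP.
apply: (@series_le_cvg _ _ (a *: sq y)) => //.
  by move=> n; exact: le_trans (xy n).
by rewrite seriesZ; exact: is_cvgZr.
Qed.

Lemma square_summable_submod_closed : submod_closed square_summable.
Proof.
split.
  apply: (@square_summable_le _ 0) => n.
  by rewrite /series /= big1// => i _; rewrite normr0 expr0n.
move=> a x y; rewrite !square_summableE => /asboolP xc /asboolP yc.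
apply/asboolP.
pose k := complex.Re `|a| ^+ 2.
apply: (@series_le_cvg _ _ (((k *+ 2) *: sq x) + (2 *: sq y))) => //.
- move=> n; rewrite addr_ge0//= mulr_ge0//.
  by rewrite mulrn_wge0// sqr_ge0.
- move=> n.
  have le1 : complex.Re `|a *: x n + y n| <=
      complex.Re `|a| * complex.Re `|x n| + complex.Re `|y n|.
    have := ler_normD (a * x n) (y n); rewrite normrM => h.
    by rewrite -lecR rmorphD rmorphM; exact: h.
  rewrite /sq -[leRHS]/(k *+ 2 * complex.Re `|x n| ^+ 2
    + 2 * complex.Re `|y n| ^+ 2) /k.
  have := Re_norm_ge0 (a *: x n + y n).
  move: (complex.Re _) le1 => s; move: (complex.Re _) => p.
  move: (complex.Re _) => q; move: (complex.Re _) => r sr s0.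
  rewrite (@le_trans _ _ ((p * q + r) ^+ 2))//.
    by rewrite ler_sqr ?nnegrE// (le_trans s0).
  rewrite -subr_ge0 (_ : _ - _ = (p * q - r) ^+ 2) ?sqr_ge0//.
  by ring.
by rewrite seriesD !seriesZ; apply: is_cvgD; exact: is_cvgZr.
Qed.

HB.instance Definition _ :=
  GRing.isSubmodClosed.Build R[i] (nat -> R[i]) square_summable
    square_summable_submod_closed.

Record ell2 := Ell2 {
  ell2_fun :> nat -> R[i];
  ell2P : ell2_fun \in square_summable
}.

HB.instance Definition _ := [isSub for ell2_fun].
HB.instance Definition _ := [Choice of ell2 by <:].
HB.instance Definition _ := [SubChoice_isSubLmodule of ell2 by <:].

Definition ell2_dot (x y : ell2) : R[i] :=
  limn (series (fun n => x n * Num.conj (y n))).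

Lemma ell2_dot_eq (x y : ell2) l :
  series (fun n => x n * Num.conj (y n)) @ \oo --> l -> ell2_dot x y = l.
Proof. exact: cvg_lim. Qed.

Lemma cvg_ell2_dot (x y : ell2) :
  series (fun n => x n * Num.conj (y n)) @ \oo --> ell2_dot x y.
Proof.
apply: (@series_le_cvgC _ _ (sq x + sq y)); last first.
  have := ell2P x; have := ell2P y; rewrite !square_summableE.
  by move=> /asboolP yc /asboolP xc; rewrite seriesD; exact: is_cvgD.
move=> n; rewrite -lecR -[(_ + _) n]/(sq x n + sq y n).
rewrite -Re_normE rmorphD /= !sqC normrM norm_conjC.
have := Re_norm_ge0 (x n); have := Re_norm_ge0 (y n).
rewrite (Re_normE (x n)) (Re_normE (y n)) -!rmorphXn -rmorphM -rmorphD lecR.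
by nra.
Qed.

Lemma ell2_dot_conj (x y : ell2) : ell2_dot x y = Num.conj (ell2_dot y x).
Proof.
apply: ell2_dot_eq; rewrite (_ : series _ =
  (fun n => Num.conj (series (fun n => y n * Num.conj (x n)) n))).
  exact: cvg_conjc (cvg_ell2_dot (x := y) (y := x)).
apply/funext => n.
rewrite /series /= rmorph_sum /=; apply: eq_bigr => i _.
by rewrite rmorphM /= conjCK mulrC.
Qed.

Lemma ell2_dotBl (z : ell2) : zmod_morphism (ell2_dot ^~ z).
Proof.
move=> x y; apply: ell2_dot_eq.
rewrite (_ : series _ = series (fun n => x n * Num.conj (z n)) -
    series (fun n => y n * Num.conj (z n))).
  exact: cvgB (cvg_ell2_dot (x := x) (y := z)) (cvg_ell2_dot (x := y) (y := z)).
apply/funext => n; rewrite fctE /series /= -sumrB; apply: eq_bigr => i _.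
by rewrite -mulrBl.
Qed.

Lemma ell2_dotZl (z : ell2) : scalable_for *%R (ell2_dot ^~ z).
Proof.
move=> a x; apply: ell2_dot_eq.
rewrite (_ : series _ = (fun n => a *: series (fun n => x n * Num.conj (z n)) n)).
  exact: cvgZr (cvg_ell2_dot (x := x) (y := z)).
apply/funext => n; rewrite /series /= scaler_sumr; apply: eq_bigr => i _.
by rewrite -[_ *: _ : R[i]]/(_ * _) mulrA.
Qed.

Lemma ell2_dotBr (z : ell2) : zmod_morphism (ell2_dot z).
Proof.
by move=> x y; rewrite ell2_dot_conj ell2_dotBl rmorphB /= -!ell2_dot_conj.
Qed.

Lemma ell2_dotZr (z : ell2) : scalable_for (Num.conj \; *%R) (ell2_dot z).
Proof.
by move=> a x; rewrite ell2_dot_conj ell2_dotZl rmorphM /= -!ell2_dot_conj.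
Qed.

HB.instance Definition _ := @isBilinear.Build R[i] ell2 ell2 R[i]
  *%R (Num.conj \; *%R) ell2_dot ell2_dotBl ell2_dotBr ell2_dotZl ell2_dotZr.

Lemma ell2_dot_hermitian (x y : ell2) :
  ell2_dot x y = (-1) ^+ false * Num.conj (ell2_dot y x).
Proof. by rewrite mul1r ell2_dot_conj. Qed.

HB.instance Definition _ := @isHermitianSesquilinear.Build R[i] ell2
  false (@Num.conj R[i]) ell2_dot ell2_dot_hermitian.

Lemma ell2_dotE (x : ell2) : ell2_dot x x = (limn (series (sq x)))%:C%C.
Proof.
apply: ell2_dot_eq; under eq_fun do rewrite -normCK.
rewrite sqE; apply: cvg_realC.
by have := ell2P x; rewrite square_summableE => /asboolP.
Qed.

Lemma ell2_partial_le (x : ell2) n : series (fun k => `|x k| ^+ 2) n <= ell2_dot x x.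
Proof.
rewrite ell2_dotE sqE lecR; apply: nondecreasing_cvgn_le.
  exact: nondecreasing_series.
by have := ell2P x; rewrite square_summableE => /asboolP.
Qed.

Lemma ell2_dot_le (x : ell2) (M : R[i]) :
  (forall n, series (fun k => `|x k| ^+ 2) n <= M) -> ell2_dot x x <= M.
Proof.
move=> xM; have xM' n : series (sq x) n <= complex.Re M.
  by have := xM n; rewrite sqE lecE => /andP[].
have M0 : complex.Im M = 0.
  by have := xM 0%N; rewrite sqE lecE => /andP[/eqP].
rewrite ell2_dotE lecE /= M0 eqxx /=; apply: limr_le.
  by have := ell2P x; rewrite square_summableE => /asboolP.
by apply: nearW.
Qed.

Lemma ell2_coord_le (x : ell2) n : `|x n| ^+ 2 <= ell2_dot x x.
Proof.
apply: le_trans (ell2_partial_le x n.+1).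
by rewrite /series /= big_nat_recr//= lerDr sumr_ge0// => i _; rewrite exprn_ge0.
Qed.

Lemma ell2_dot_gt0 (x : ell2) : x != 0 -> 0 < ell2_dot x x.
Proof.
move=> x0; have [n xn0] : exists n, x n != 0.
  apply/not_existsP => x0'; move/eqP: x0; apply; apply/val_inj/funext => n /=.
  by apply/eqP/negP => xn; apply: (x0' n); apply/negP.
apply: lt_le_trans (ell2_coord_le x n).
by rewrite exprn_gt0// normr_gt0.
Qed.

HB.instance Definition _ := @isDotProduct.Build R[i] ell2 ell2_dot ell2_dot_gt0.

HB.instance Definition _ := Lmodule_hasInner.Build R ell2 ell2_dot.

Lemma ell2_innerE (x y : ell2) :
  inner x y = limn (series (fun n => x n * Num.conj (y n))).
Proof. by []. Qed.

Lemma ell2_normE (x : ell2) : `|x| ^+ 2 = ell2_dot x x.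
Proof. by rewrite -(inner_norm x). Qed.

Lemma ell2_coord_norm (x : ell2) n : `|x n| <= `|x|.
Proof.
by rewrite -ler_sqr ?nnegrE// ell2_normE; exact: ell2_coord_le.
Qed.

Lemma ell2_is_complete (F : set_system ell2) :
  ProperFilter F -> cauchy F -> cvg F.
Proof.
move=> FF /cauchy_ballP Fc.
have coord n : cvg ((fun x : ell2 => x n) @ F).
  apply: (@cauchy_cvg R[i]); apply/cauchy_ballP => e e0.
  case: (Fc e e0) => -[A B] /= [FA FB] AB.
  exists ((fun x : ell2 => x n) @` A, (fun x : ell2 => x n) @` B) => /=.
    by split; [apply: filterS FA|apply: filterS FB] => z Az; exists z.
  case=> _ _ [[x Ax <-] [y By <-]] /=.
  have := AB (x, y) (conj Ax By); rewrite /= -!ball_normE /=.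
  by apply: le_lt_trans; exact: (ell2_coord_norm (x - y)).
pose l n := lim ((fun x : ell2 => x n) @ F).
have close e : 0 < e -> F [set x : ell2 |
    forall n, series (fun k => `|x k - l k| ^+ 2) n <= e ^+ 2].
  move=> e0; case: (Fc e e0) => -[A B] /= [FA FB] AB.
  apply: filterS FA => x Ax n.
  have /Re_gt0[ee eRe0] := e0.
  have cv : \sum_(0 <= k < n) complex.Re (`|x k - y k| ^+ 2) @[y --> F] -->
      \sum_(0 <= k < n) complex.Re (`|x k - l k| ^+ 2).
    apply: cvg_big => [|k _]; first exact: add_continuous.
    apply: cvg_Re; rewrite expr2; under eq_fun do rewrite expr2.
    by apply: cvgM; apply: cvg_norm; apply: cvgB (cvg_cst _) (coord k).
  have -> : series (fun k => `|x k - l k| ^+ 2) n =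
      (\sum_(0 <= k < n) complex.Re (`|x k - l k| ^+ 2))%:C%C.
    rewrite /series rmorph_sum; apply: eq_bigr => k _; apply: esym.
    by apply: RRe_real; rewrite realX// normr_real.
  have -> : e ^+ 2 = (complex.Re e ^+ 2)%:C%C by rewrite {1}ee rmorphXn.
  rewrite lecR; apply: cvgr_to_le cv _.
  apply: filterS FB => y By /=.
  have := AB (x, y) (conj Ax By); rewrite /= -!ball_normE /= => xye.
  rewrite -lecR rmorph_sum (_ : (complex.Re e ^+ 2)%:C%C = e ^+ 2); last first.
    by rewrite [in RHS]ee rmorphXn.
  rewrite (@le_trans _ _ (`|x - y| ^+ 2))//; last first.
    by rewrite ler_sqr ?nnegrE// ltW.
  rewrite ell2_normE; apply: le_trans (ell2_partial_le (x - y) n).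
  rewrite /series; apply: ler_sum => k _; rewrite le_eqVlt; apply/orP; left.
  apply/eqP; rewrite -[RHS]RRe_real//.
have lP : l \in square_summable.
  have [x xl] := filter_ex (close 1 ltr01).
  have -> : l = (x : nat -> R[i]) - (fun k => x k - l k).
    by apply/funext => k; rewrite !fctE opprB addrC subrK.
  rewrite rpredB ?ell2P//; apply: square_summable_le => n; exact: xl.
apply/cvg_ex; exists (Ell2 lP); apply/cvgrPdist_lt => e e0.
have e20 : 0 < e / 2 by rewrite divr_gt0.
near=> x; rewrite (@le_lt_trans _ _ (e / 2))//; last first.
  by rewrite ltr_pdivrMr// mulr_natr mulr2n ltrDl.
rewrite distrC -ler_sqr ?nnegrE ?(ltW e20)// ell2_normE.
apply: ell2_dot_le; near: x; exact: close.
Unshelve. all: by end_near. Qed.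

HB.instance Definition _ := Uniform_isComplete.Build ell2 ell2_is_complete.

End ell2.

Section operators.
Variable R : realType.

(* The supremum is taken in \bar R, so that an unbounded T has norm +oo. *)
Definition opnorm (V W : normedModType R[i]) (T : V -> W) : \bar R :=
  ereal_sup [set (complex.Re `|T x|)%:E | x in [set x : V | `|x| <= 1]].

Definition is_adjoint (H K : preHilbertType R) (T : H -> K) (S : K -> H) :=
  forall x y, inner (T x) y = inner x (S y).

(* On a Hilbert space, a bounded operator has exactly one adjoint. *)
Definition normal_op (H : hilbertType R) (N : {linear H -> H}) :=
  bounded_near N (nbhs 0) /\
  exists S : {linear H -> H}, [/\ bounded_near S (nbhs 0),
    is_adjoint N S & forall x, N (S x) = S (N x)].

Definition closed_subspace (V : normedModType R[i]) (M : set V) :=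
  [/\ M 0, forall a x y, M x -> M y -> M (a *: x + y) & closed M].

(* T is a restriction N|_M up to the unitary identification U of H with M. *)
Definition subnormal (H : hilbertType R) (T : {linear H -> H}) :=
  exists (K : hilbertType R) (N : {linear K -> K}) (M : set K),
    [/\ normal_op N, closed_subspace M, N @` M `<=` M &
        exists U : {linear H -> K},
          [/\ forall x y, inner (U x) (U y) = inner x y, range U = M
            & forall x, U (T x) = N (U x)]].

End operators.

Section weighted_shift.
Variable R : realType.
Implicit Types (x : ell2 R) (n : nat).

Definition ell2_basis_fun n : nat -> R[i] := fun k => (k == n)%:R.

Lemma ell2_basis_summable n : ell2_basis_fun n \in @square_summable R.
Proof.
apply: (@square_summable_le _ _ 1) => m; rewrite /series /= /ell2_basis_fun.
have [nm|mn] := ltnP n m.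
  rewrite big_mkord (bigD1 (Ordinal nm))//= eqxx normr1 expr1n big1 ?addr0//.
  by move=> i; rewrite -val_eqE /= => /negPf->; rewrite normr0 expr0n.
rewrite big_mkord big1 ?ler01// => i _.
by rewrite ltn_eqF ?normr0 ?expr0n// (leq_trans _ mn).
Qed.

Definition ell2_basis n : ell2 R := Ell2 (ell2_basis_summable n).

Variables (alpha : nat -> R) (alpha_bounded : bounded_fun alpha).

Definition wshift_fun (x : nat -> R[i]) : nat -> R[i] :=
  fun n => if n is k.+1 then (alpha k)%:C%C * x k else 0.

Lemma weights_bound : exists2 M : R, 0 <= M & forall n, `|alpha n| <= M.
Proof.
have [M [_ aM]] := alpha_bounded.
exists (`|M| + 1) => [|n]; first by rewrite addr_ge0.
by apply: aM => //; rewrite (le_lt_trans (ler_norm M))// ltrDl.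
Qed.

Lemma wshift_fun_le (M : R) x n : (forall k, `|alpha k| <= M) ->
  series (fun k => `|wshift_fun x k| ^+ 2) n <= (M%:C%C * `|x|) ^+ 2.
Proof.
move=> aM; have M0 : 0 <= M := le_trans (normr_ge0 _) (aM 0%N).
case: n => [|n].
  by rewrite /series /= big_geq// exprn_ge0// mulr_ge0// ler0c.
rewrite /series /= big_nat_recl//= normr0 expr0n add0r exprMn.
rewrite (@le_trans _ _ (\sum_(0 <= k < n) M%:C%C ^+ 2 * `|x k| ^+ 2))//.
  apply: ler_sum => k _; rewrite normrM exprMn ler_wpM2r ?exprn_ge0//.
  have aMk : `|(alpha k)%:C%C : R[i]| <= M%:C%C by rewrite norm_realC lecR.
  by rewrite ler_sqr ?nnegrE// ler0c.
rewrite -mulr_sumr ler_wpM2l ?exprn_ge0 ?ler0c//.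
by rewrite ell2_normE; exact: ell2_partial_le.
Qed.

Lemma wshift_summable x : wshift_fun x \in @square_summable R.
Proof.
have [M _ aM] := weights_bound.
by apply: square_summable_le => n; exact: wshift_fun_le.
Qed.

Definition wshift x : ell2 R := Ell2 (wshift_summable x).

Lemma wshift_is_linear : linear wshift.
Proof.
move=> a x y; apply/val_inj/funext => -[|k] /=.
  by rewrite !fctE /= scaler0 addr0.
by rewrite !fctE /= mulrDr -[_ *: _ : R[i]]/(_ * _) -[_ *: _ : R[i]]/(_ * _) mulrCA.
Qed.

HB.instance Definition _ := GRing.isLinear.Build R[i] (ell2 R) (ell2 R) _
  wshift wshift_is_linear.

Lemma wshift_bounded : bounded_near wshift (nbhs 0).
Proof.
have [M M0 aM] := weights_bound.
apply/linear_boundedP; exists M%:C%C; split=> [|r Mr x].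
  by apply/complex_realP; exists M.
rewrite (@le_trans _ _ (M%:C%C * `|x|))//; last by rewrite ler_wpM2r// ltW.
rewrite -ler_sqr ?nnegrE// ?mulr_ge0 ?ler0c//.
by rewrite ell2_normE; apply: ell2_dot_le => n; exact: wshift_fun_le.
Qed.

Lemma wshift_basis n :
  wshift (ell2_basis n) = (alpha n)%:C%C *: ell2_basis n.+1.
Proof.
apply/val_inj/funext => -[|k] /=; first by rewrite fctE /= scaler0.
rewrite fctE /= /ell2_basis_fun eqSS -[RHS]/(_ * _).
by have [->//|] := eqVneq; rewrite !mulr0.
Qed.

End weighted_shift.

Section moments.
Variable R : realType.
Implicit Types (a alpha : nat -> R).

Definition moment alpha n : R := \prod_(j < n) alpha j ^+ 2.

Definition nabla a : nat -> R := fun n => a n - a n.+1.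

Definition hankel a i r : 'M[R]_r.+1 := \matrix_(s, t) a (i + s + t)%N.

Definition qform n (A : 'M[R[i]]_n) (c : 'I_n -> R[i]) : R[i] :=
  \sum_s \sum_t A s t * Num.conj (c s) * c t.

(* "Positive definite" is understood as positive semi-definite. *)
Definition posdef_mx n (A : 'M[R[i]]_n) :=
  A \is hermsymmx /\ forall c, 0 <= qform A c.

Definition cond_posdef_mx n (A : 'M[R[i]]_n) :=
  A \is hermsymmx /\ forall c, \sum_s c s = 0 -> 0 <= qform A c.

Definition nabla_hankel alpha m i r : 'M[R[i]]_r.+1 :=
  map_mx (real_complex R) (hankel (iter m nabla (moment alpha)) i r).

(* W_alpha is (k,2m)-PD, resp. (k,2m)-CPD; meaningful for m <= k, as k - m is a
   truncated subtraction. *)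
Definition shift_PD alpha k m :=
  forall i, posdef_mx (nabla_hankel alpha (2 * m) i (k - m)).

Definition shift_CPD alpha k m :=
  forall i, cond_posdef_mx (nabla_hankel alpha (2 * m) i (k - m)).

End moments.

(* Main.v *)
From HB Require Import structures.
Require Import Defs.
From mathcomp Require Import all_boot all_order all_algebra.
From mathcomp Require Import all_classical all_reals all_analysis.
From mathcomp Require Import complex ring.

(* Write L p = \sum_i p_i gamma_i.  Since a CPD Hankel form of a sequence is a
   PSD form of its second difference, the hypotheses say that
   L ((1 - X)^(2m+2) X^i p^2) >= 0 for all i and p.  The quantity
   L (X^i (1 - X)^n p^2) decreases in i as soon as its analogue for n + 1 is
   nonnegative, and it has a nonnegative limit because gamma decreases to some
   g >= 0; hence all the factors 1 - X can be removed one by one, and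
   L (X^i p^2) >= 0, L (X^i (1 - X) p^2) >= 0.

   The sequence gamma_0, 0, gamma_1, 0, gamma_2, ... is then the moment sequence
   of a symmetric functional for which multiplication by X is a contraction.  Its
   orthonormal polynomials satisfy X p_j = b_j p_{j+1} + b_{j-1} p_{j-1} with
   b_j in [0, 1], so the Jacobi matrix A with entries b_j satisfies
   |A^k e|^2 = gamma_k.  On l^2(Z x Z) the operator N = (bilateral shift) (x) A is
   bounded and normal, the vectors N^k e are orthogonal of square norm gamma_k,
   and W_alpha is the restriction of N to their closed span. *)

Set Implicit Arguments.
Unset Strict Implicit.
Unset Printing Implicit Defensive.

Import Order.TTheory GRing.Theory Num.Theory.
Import numFieldNormedType.Exports.

Local Open Scope classical_set_scope.
Local Open Scope ring_scope.

(** * Orthogonal polynomials of a symmetric contractive functional *)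

Section orthogonal_polynomials.
Variables (R : realType) (Lam : {scalar {poly R}}).
Hypothesis Lam_sqr_ge0 : forall p, 0 <= Lam (p * p).

Let LamD p q : Lam (p + q) = Lam p + Lam q. Proof. exact: linearD. Qed.

Let LamB p q : Lam (p - q) = Lam p - Lam q. Proof. exact: linearB. Qed.

Let LamZ a p : Lam (a *: p) = a * Lam p. Proof. exact: linearZ. Qed.

Let Lam0 : Lam 0 = 0. Proof. exact: linear0. Qed.

(** Cauchy-Schwarz at a null vector: if [Lam (q * p)] were nonzero, t |-> Lam ((q - t p)^2) would be
    affine and nonconstant, and the [t] chosen below gives it the value -1. *)
Lemma Lam_null p q : Lam (p * p) = 0 -> Lam (q * p) = 0.
Proof.
move=> p0; apply/eqP/negP => /negP qp0.
have := Lam_sqr_ge0 (q - ((Lam (q * q) + 1) / (2 * Lam (q * p))) *: p).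
set t := _ / _.
have -> : (q - t *: p) * (q - t *: p) = q * q - (t + t) *: (q * p) + t ^+ 2 *: (p * p).
  by rewrite -!mul_polyC rmorphD rmorphXn /=; ring.
rewrite LamD LamB !LamZ p0 mulr0 addr0.
have -> : (t + t) * Lam (q * p) = Lam (q * q) + 1 by rewrite /t; field.
by rewrite opprD addNKr lerNr oppr0 ler10.
Qed.

(* The indexing is shifted by one, ortho 0 = 0 playing the role of the polynomial
   of degree -1; as x / 0 = 0, the recursion and the Jacobi coefficients below
   need no special case at 0 or when the functional is degenerate. *)
Fixpoint ortho_pair n : {poly R} * {poly R} :=
  if n is n'.+1 then
    let (p, q) := ortho_pair n' in
    (q, 'X * q - (Lam (q * q) / Lam (p * p)) *: p)
  else (0, 1).

Definition ortho n := (ortho_pair n).1.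

Definition ortho_sqr n : R := Lam (ortho n * ortho n).

Lemma ortho0 : ortho 0 = 0. Proof. by []. Qed.

Lemma ortho1 : ortho 1 = 1. Proof. by []. Qed.

Lemma orthoSS n : ortho n.+2 =
  'X * ortho n.+1 - (ortho_sqr n.+1 / ortho_sqr n) *: ortho n.
Proof. by rewrite /ortho_sqr /ortho /=; case: (ortho_pair n). Qed.

Lemma mulX_ortho n : 'X * ortho n.+1 =
  ortho n.+2 + (ortho_sqr n.+1 / ortho_sqr n) *: ortho n.
Proof. by rewrite orthoSS subrK. Qed.

(** For n >= 1, [ortho n] has degree n - 1, and the recursion preserves parity; hence the parity
    opposite to that of n. *)
Lemma ortho_parity n i : odd i = odd n -> (ortho n)`_i = 0.
Proof.
elim/ltn_ind: n i => -[|[|n]] IH i /=; first by rewrite ortho0 coef0.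
  by rewrite ortho1 coef1; case: i.
rewrite negbK => io; rewrite orthoSS coefB coefXM coefZ (IH n)// mulr0 subr0.
by case: i io => [//|i] /= io; rewrite (IH n.+1)//= -io negbK.
Qed.

Hypothesis Lam_odd : forall p : {poly R},
  (forall i, ~~ odd i -> p`_i = 0) -> Lam p = 0.

(** The argument of [Lam] is an odd polynomial. These are the diagonal entries of the Jacobi matrix,
    whose vanishing explains why [orthoSS] has no term in [ortho n.+1] alone. *)
Lemma Lam_X_ortho_sqr n : Lam ('X * (ortho n * ortho n)) = 0.
Proof.
apply: Lam_odd => i ei; rewrite coefXM; case: i ei => [//|i] /=.
rewrite negbK => oi; rewrite coefM big1// => -[j /= ji] _.
have [jn|jn] := eqVneq (odd j) (odd n); first by rewrite ortho_parity ?mul0r.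
rewrite (@ortho_parity n (i - j)) ?mulr0// oddB// oi.
by move: jn; case: (odd j); case: (odd n).
Qed.

Hypothesis Lam_contract : forall p, Lam ('X * p * ('X * p)) <= Lam (p * p).

(** By [mulX_ortho] and Pythagoras, the square norm of X times [ortho n.+1] is at least
    [ortho_sqr n.+2]; contractivity bounds it from above. Orthogonality is a premise because the
    induction of [ortho_orthogonal] calls this lemma. *)
Lemma ortho_sqr_le n : Lam (ortho n.+2 * ortho n) = 0 ->
  ortho_sqr n.+2 <= ortho_sqr n.+1.
Proof.
move=> orth; apply: le_trans (Lam_contract _).
rewrite mulX_ortho.
set l := _ / _.
have -> : (ortho n.+2 + l *: ortho n) * (ortho n.+2 + l *: ortho n) =
   ortho n.+2 * ortho n.+2 + (l + l) *: (ortho n.+2 * ortho n) +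
   (l ^+ 2) *: (ortho n * ortho n).
  by rewrite -!mul_polyC rmorphD rmorphXn /=; ring.
rewrite 2!LamD !LamZ orth mulr0 addr0 lerDl.
by rewrite mulr_ge0 ?sqr_ge0 ?Lam_sqr_ge0.
Qed.

Lemma ortho_orthogonal n m : (m < n)%N -> Lam (ortho n * ortho m) = 0.
Proof.
elim/ltn_ind: n m => -[//|[|n]] IH m.
  by rewrite ltnS leqn0 => /eqP ->; rewrite ortho0 mulr0 Lam0.
rewrite ltnS leq_eqVlt => /predU1P[->|mn].
  rewrite orthoSS mulrBl LamB -mulrA Lam_X_ortho_sqr sub0r -scalerAl.
  by rewrite LamZ [_ * ortho n.+1]mulrC IH// mulr0 oppr0.
rewrite orthoSS mulrBl LamB -scalerAl LamZ.
have -> : 'X * ortho n.+1 * ortho m = ortho n.+1 * ('X * ortho m) by ring.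
case: m mn => [|m] mn; first by rewrite ortho0 !mulr0 Lam0 mulr0 subr0.
rewrite mulX_ortho mulrDr -scalerAr LamD LamZ (IH n.+1 _ m) //; last first.
  by rewrite (leq_trans _ mn).
rewrite mulr0 addr0.
move: mn; rewrite ltnS leq_eqVlt => /predU1P[nm|mn]; last first.
  by rewrite !IH ?mulr0 ?subrr// !ltnS// ltnW.
rewrite -nm -![Lam (ortho _ * ortho _)]/(ortho_sqr _).
(* If the divisor is 0, the quotient is 0 and nothing cancels; contractivity then forces the next
   square norm to vanish as well. *)
have [h0|h0] := eqVneq (ortho_sqr m.+1) 0; last first.
  by rewrite divfK ?subrr.
rewrite h0 mulr0 subr0; apply/eqP; rewrite eq_le Lam_sqr_ge0 andbT -h0.
by rewrite ortho_sqr_le// IH// nm.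
Qed.

Let s n := Num.sqrt (ortho_sqr n).

Let s_ge0 n : 0 <= s n. Proof. exact: sqrtr_ge0. Qed.

Let s_sqr n : s n ^+ 2 = ortho_sqr n.
Proof. by rewrite sqr_sqrtr ?Lam_sqr_ge0. Qed.

(** Off-diagonal entries of the Jacobi matrix in the basis [ortho n / s n]. Since [s 0 = 0], the
    entry at 0 is 0, so the matrix extends by zero to indices in Z without coupling to the negative
    side. *)
Definition jacobi_coef (j : int) : R :=
  if j is Posz n then s n.+1 / s n else 0.

(** Coordinates of X^k along the orthonormal polynomials [ortho n / s n]. *)
Definition ortho_coord k (j : int) : R :=
  if j is Posz n then Lam ('X^k * ortho n) / s n else 0.

Lemma jacobi_coef_le1 j : `|jacobi_coef j| <= 1.
Proof.
case: j => n /=; rewrite ?normr0 ?ler01//.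
rewrite ger0_norm ?divr_ge0//.
case: n => [|n].
  by rewrite {2}/s /ortho_sqr ortho0 mulr0 Lam0 sqrtr0 invr0 mulr0 ler01.
have [->|h0] := eqVneq (s n.+1) 0; first by rewrite invr0 mulr0 ler01.
rewrite ler_pdivrMr ?mul1r ?lt_def ?h0 ?s_ge0//.
by rewrite ler_wsqrtr// ortho_sqr_le// ortho_orthogonal.
Qed.

Lemma ortho_coord_null n q : s n = 0 -> Lam (q * ortho n) = 0.
Proof. by move=> sn0; apply: Lam_null; rewrite -[LHS]/(ortho_sqr n) -s_sqr sn0 expr0n. Qed.

Lemma ortho_coordS k (j : int) : ortho_coord k.+1 j =
  jacobi_coef (j - 1) * ortho_coord k (j - 1) + jacobi_coef j * ortho_coord k (j + 1).
Proof.
case: j => [[|n]|n].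
- rewrite sub0r -[- 1]/(Negz 0) /= mul0r add0r ortho0 mulr0 Lam0 mul0r.
  by rewrite {2}/s /ortho_sqr ortho0 mulr0 Lam0 sqrtr0 invr0 mulr0 mul0r.
- have -> : Posz n.+1 - 1 = n by rewrite -addn1 PoszD addrK.
  rewrite -PoszD addn1 /= exprSr -mulrA mulX_ortho mulrDr -scalerAr LamD LamZ.
  rewrite -!s_sqr.
  (* Zero norms are split off before [field]. When [s n.+2 = 0], its term on the left carries no
     factor [s n.+2], and vanishes only thanks to [ortho_coord_null]. *)
  have [sn1|sn1] := eqVneq (s n.+1) 0; first by rewrite sn1 invr0; ring.
  have [sn2|sn2] := eqVneq (s n.+2) 0.
    rewrite (ortho_coord_null _ sn2) sn2 invr0 !mulr0 add0r addr0.
    have [sn|sn] := eqVneq (s n) 0; first by rewrite sn invr0 expr0n /= invr0 !mulr0 ?mul0r.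
    by field; rewrite sn sn1.
  have [sn|sn] := eqVneq (s n) 0.
    rewrite sn invr0 expr0n /= invr0; field.
    by rewrite sn1 sn2.
  by field; rewrite sn sn1 sn2.
- have -> : Negz n - 1 = Negz n.+1 by rewrite !NegzE -opprD -PoszD addn1.
  by rewrite /= !mul0r addr0.
Qed.

Hypothesis Lam1 : Lam 1 = 1.

Lemma sqrt_ortho_sqr1 : s 1 = 1.
Proof. by rewrite /s /ortho_sqr ortho1 mulr1 Lam1 sqrtr1. Qed.

Lemma ortho_coord0 j : ortho_coord 0 j = (j == 1)%:R.
Proof.
case: j => [[|[|n]]|n]//=.
- by rewrite ortho0 mulr0 Lam0 mul0r.
- by rewrite ortho1 mulr1 expr0 Lam1 sqrt_ortho_sqr1 divr1.
- have -> : 'X^0 * ortho n.+2 = ortho n.+2 * ortho 1 by rewrite ortho1; ring.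
  by rewrite ortho_orthogonal// mul0r.
Qed.

Lemma ortho_coord1 k : ortho_coord k 1 = Lam 'X^k.
Proof. by rewrite /= ortho1 mulr1 sqrt_ortho_sqr1 divr1. Qed.

End orthogonal_polynomials.

Lemma conj_realC (R : realType) (r : R) : Num.conj (r%:C%C : R[i]) = r%:C%C.
Proof. by apply/conj_Creal/complex_realP; exists r. Qed.

(** * Positivity of the moment functional *)

Section moment_functional.
Variable R : realType.
Implicit Types (a : nat -> R) (p q : {poly R}).

Definition moment_functional a p : R := \sum_(i < size p) p`_i * a i.

Lemma moment_functional_wide a p n : (size p <= n)%N ->
  moment_functional a p = \sum_(i < n) p`_i * a i.
Proof.
move=> pn; rewrite /moment_functional -!(big_mkord predT (fun i => p`_i * a i)).
rewrite (big_cat_nat (leq0n _) pn) /= [X in _ = _ + X]big_nat_cond.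
rewrite [X in _ = _ + X]big1 ?addr0// => i /andP[/andP[pi _] _].
by rewrite nth_default ?mul0r.
Qed.

Lemma moment_functional_is_linear a : scalar (moment_functional a).
Proof.
move=> c p q.
have pn := leq_maxl (size p) (size q); have qn := leq_maxr (size p) (size q).
rewrite !(@moment_functional_wide _ _ (maxn (size p) (size q)))//; last first.
  by rewrite (leq_trans (size_polyD _ _))// geq_max qn andbT (leq_trans (size_scale_leq _ _)).
rewrite mulr_sumr -big_split /=; apply: eq_bigr => i _.
by rewrite coefD coefZ mulrDl mulrA.
Qed.

HB.instance Definition _ a := GRing.isLinear.Build R {poly R} R _
  (moment_functional a) (moment_functional_is_linear a).

Lemma moment_functionalXn a n : moment_functional a 'X^n = a n.
Proof.
rewrite (@moment_functional_wide _ _ n.+1) ?size_polyXn// big_ord_recr /=.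
rewrite coefXn eqxx mul1r big1 ?add0r// => i _.
by rewrite coefXn ltn_eqF ?mul0r// ltn_ord.
Qed.

Lemma moment_functionalMXn a i q :
  moment_functional a ('X^i * q) = \sum_(j < size q) q`_j * a (i + j)%N.
Proof.
rewrite -[in LHS](coefK q) poly_def mulr_sumr linear_sum; apply: eq_bigr => j _.
by rewrite -scalerAr -exprD linearZ /= moment_functionalXn.
Qed.

Lemma moment_functional_nabla a p :
  moment_functional (nabla a) p = moment_functional a ((1 - 'X) * p).
Proof.
rewrite -[in RHS](coefK p) poly_def mulr_sumr linear_sum; apply: eq_bigr => j _.
rewrite -scalerAr mulrBl mul1r -exprS linearZ linearB /=.
by rewrite !moment_functionalXn.
Qed.

Lemma moment_functional_iter_nabla a n p :
  moment_functional (iter n (@nabla R) a) p = moment_functional a ((1 - 'X) ^+ n * p).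
Proof.
elim: n p => [|n IH] p; first by rewrite expr0 mul1r.
by rewrite iterS moment_functional_nabla IH exprSr mulrA.
Qed.

Lemma qform_hankel a i r q : (size q <= r.+1)%N ->
  qform (map_mx (real_complex R) (hankel a i r)) (fun s => (q`_s)%:C%C) =
  (moment_functional a ('X^i * (q * q)))%:C%C.
Proof.
move=> qr.
have qE : q = \sum_(s < r.+1) q`_s *: 'X^s.
  rewrite -poly_def; apply/polyP => s; rewrite coef_poly.
  by case: ltnP => // rs; rewrite nth_default// (leq_trans qr).
rewrite {2 3}qE mulr_suml mulr_sumr linear_sum rmorph_sum; apply: eq_bigr => s _.
rewrite !mulr_sumr linear_sum rmorph_sum; apply: eq_bigr => t _.
have -> : 'X^i * (q`_s *: 'X^s * (q`_t *: 'X^t)) = (q`_s * q`_t) *: 'X^(i + s + t).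
  by rewrite -!mul_polyC rmorphM /= !exprD; ring.
rewrite linearZ /= moment_functionalXn !mxE.
rewrite conj_realC -!rmorphM /=; congr (_%:C)%C; ring.
Qed.

(** The coefficients of q sum to [q.[1]], so the CPD constraint on the vector becomes a root at
    1. *)
Lemma cond_posdef_moment_functional a i r q :
  cond_posdef_mx (map_mx (real_complex R) (hankel a i r)) ->
  (size q <= r.+1)%N -> q.[1] = 0 -> 0 <= moment_functional a ('X^i * (q * q)).
Proof.
move=> [_ cpd] qr q1; rewrite -ler0c -(qform_hankel _ _ qr); apply: cpd.
rewrite -rmorph_sum /= (_ : \sum_(s < r.+1) q`_s = 0) ?rmorph0//.
rewrite -[RHS]q1 (horner_coef_wide _ qr).
by apply: eq_bigr => s _; rewrite expr1n mulr1.
Qed.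

Lemma moment_functional_cvg a g q : a @ \oo --> g ->
  moment_functional a ('X^i * q) @[i --> \oo] --> q.[1] * g.
Proof.
move=> ag; under eq_fun do rewrite moment_functionalMXn.
rewrite horner_coef mulr_suml.
apply: cvg_big => [|j _]; first exact: add_continuous.
rewrite expr1n mulr1; apply: cvgM; first exact: cvg_cst.
by move: ag; rewrite -(cvg_shiftn j).
Qed.

(** The hypothesis says that the values decrease in i; they are therefore bounded below by their
    limit [q.[1] * g]. *)
Lemma moment_functional_descent a g q : a @ \oo --> g -> 0 <= q.[1] * g ->
  (forall i, 0 <= moment_functional a ('X^i * ((1 - 'X) * q))) ->
  forall i, 0 <= moment_functional a ('X^i * q).
Proof.
move=> ag qg0 dq i; have qcvg := moment_functional_cvg (q := q) ag.
apply: (le_trans qg0); rewrite -(cvg_lim (@Rhausdorff R) qcvg).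
apply: (nonincreasing_cvgn_ge (u_ := fun i => moment_functional a ('X^i * q))).
  apply/nonincreasing_seqP => n; rewrite -subr_ge0 -linearB /=.
  by have := dq n; congr (_ <= moment_functional a _); rewrite exprS; ring.
by apply/cvg_ex; eexists; exact: qcvg.
Qed.

Lemma moment_functional_iter_descent a g n q : a @ \oo --> g -> 0 <= g ->
  0 <= q.[1] ->
  (forall i, 0 <= moment_functional a ('X^i * ((1 - 'X) ^+ n * q))) ->
  forall i, 0 <= moment_functional a ('X^i * q).
Proof.
move=> ag g0 q0; elim: n => [|n IH] dn i; first by have := dn i; rewrite expr0 mul1r.
apply: IH; apply: (moment_functional_descent ag); last first.
  by move=> j; have := dn j; rewrite exprS -mulrA.
(* While a factor 1 - X remains, the limit is 0; once all are removed, it is [q.[1] * g]. *)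
rewrite mulr_ge0//; case: n {dn} => [|n]; first by rewrite expr0 mul1r.
rewrite exprS -mulrA hornerM (_ : (1 - 'X).[1] = 0) ?mul0r//.
by rewrite hornerD hornerN hornerX hornerC subrr.
Qed.

End moment_functional.

(** * Symmetrization of a moment sequence and its Jacobi matrix *)

Section symmetrization.
Variable R : realType.
Implicit Types (a : nat -> R) (p q : {poly R}).

Lemma even_poly_comp_polyX2 p : even_poly (p \Po 'X^2) = p.
Proof.
apply/polyP => i; rewrite coef_even_poly coef_comp_poly_Xn// -muln2.
by rewrite dvdn_mull// mulnK.
Qed.

Lemma odd_poly_comp_polyX2 p : odd_poly (p \Po 'X^2) = 0.
Proof.
apply/polyP => i; rewrite coef_odd_poly coef_comp_poly_Xn// coef0.
by rewrite dvdn2 /= odd_double.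
Qed.

(** With p = e(X^2) + X o(X^2), the even part of p^2 comes from e^2 and X^2 o^2. Positivity of the
    symmetrized functional thus reduces to that of L on e^2 and on X o^2. *)
Lemma even_poly_sqr p : even_poly (p * p) =
  even_poly p * even_poly p + 'X * (odd_poly p * odd_poly p).
Proof.
set e := even_poly p; set o := odd_poly p.
have -> : p * p = ((e * e + 'X * (o * o)) \Po 'X^2) + (((e * o) *+ 2) \Po 'X^2) * 'X.
  rewrite -{1 2}(poly_even_odd p) -/e -/o comp_polyD mulr2n comp_polyD.
  by rewrite !comp_polyM comp_polyX; ring.
by rewrite raddfD /= even_poly_comp_polyX2 even_polyMX odd_poly_comp_polyX2 mul0r addr0.
Qed.

(* The functional with moments a 0, 0, a 1, 0, a 2, and so on. *)
Definition even_moment_functional a : {poly R} -> R :=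
  fun p => moment_functional a (even_poly p).

Lemma even_moment_functional_is_linear a : scalar (even_moment_functional a).
Proof. by move=> c p q; rewrite /even_moment_functional !linearP. Qed.

HB.instance Definition _ a := GRing.isLinear.Build R {poly R} R _
  (even_moment_functional a) (even_moment_functional_is_linear a).

(** [v k] lists the coordinates of X^k, that is A^k applied to the basis vector at 1. The first
    positivity makes the symmetrized functional positive, the second makes multiplication by X a
    contraction. *)
Lemma jacobi_recurrence a : a 0%N = 1 ->
  (forall i p, 0 <= moment_functional a ('X^i * (p * p))) ->
  (forall i p, 0 <= moment_functional a ('X^i * ((1 - 'X) * (p * p)))) ->
  exists (b : int -> R) (v : nat -> int -> R),
    [/\ forall j, `|b j| <= 1,
        forall j, v 0%N j = (j == 1)%:R,
        forall k j, v k.+1 j = b (j - 1) * v k (j - 1) + b j * v k (j + 1)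
      & forall k, v k.*2 1 = a k].
Proof.
move=> a0 psd psd1; pose Lam : {scalar {poly R}} := even_moment_functional a.
have Lam_sqr p : 0 <= Lam (p * p).
  rewrite -[Lam _]/(moment_functional a _) even_poly_sqr linearD /=.
  rewrite addr_ge0//; last exact: (psd 1%N).
  by have := psd 0%N (even_poly p); rewrite expr0 mul1r.
have Lam_odd p : (forall i, ~~ odd i -> p`_i = 0) -> Lam p = 0.
  move=> po; rewrite -[Lam _]/(moment_functional a _).
  rewrite (_ : even_poly p = 0) ?linear0//; apply/polyP => i.
  by rewrite coef_even_poly po ?coef0// odd_double.
have Lam_contract p : Lam ('X * p * ('X * p)) <= Lam (p * p).
  rewrite -subr_ge0 -[Lam _]/(moment_functional a _) -[X in _ - X]/(moment_functional a _).
  rewrite (_ : 'X * p * ('X * p) = (p * p) * 'X * 'X); last by ring.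
  rewrite even_polyMX odd_polyMX -linearB /= even_poly_sqr.
  set e := even_poly p; set o := odd_poly p.
  (* Multiplication by X^2 acts on even parts as multiplication by X, so the difference is L applied
     to (1 - X)(e^2 + X o^2). *)
  rewrite (_ : _ - _ = 'X^0 * ((1 - 'X) * (e * e)) + 'X^1 * ((1 - 'X) * (o * o))).
    by rewrite linearD addr_ge0 ?psd1.
  by rewrite expr0 expr1; ring.
have Lam1 : Lam 1 = 1.
  rewrite -[Lam _]/(moment_functional a _) -[X in even_poly X]/(1%:P).
  by rewrite even_polyC -[RHS]a0 -moment_functionalXn expr0.
exists (jacobi_coef Lam), (ortho_coord Lam); split.
- exact: jacobi_coef_le1.
- exact: ortho_coord0.
- exact: ortho_coordS.
- move=> k; rewrite ortho_coord1// -[Lam _]/(moment_functional a _).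
  rewrite -moment_functionalXn -[in RHS](even_poly_comp_polyX2 'X^k).
  by rewrite rmorphXn /= comp_polyX -exprM mul2n.
Qed.

End symmetrization.

(** * Operators on the sequence space *)

Section ell2_density.
Variable R : realType.
Implicit Types (x y : ell2 R).

Lemma ell2_sum_fun (I : Type) (r : seq I) (P : pred I) (F : I -> ell2 R) n :
  (\sum_(i <- r | P i) F i) n = \sum_(i <- r | P i) F i n.
Proof.
by elim/big_rec2: _ => [//|i y1 y2 _ <-].
Qed.

Lemma ell2_basisE n k : ell2_basis R n k = (k == n)%:R.
Proof. by []. Qed.

Lemma ell2_trunc_cvg x :
  (\sum_(k < n) x k *: ell2_basis R k) @[n --> \oo] --> x.
Proof.
have sq_cvg : cvgn (series (fun k => complex.Re `|x k| ^+ 2)).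
  by have := ell2P x; rewrite square_summableE => /asboolP.
set S := series _ in sq_cvg.
have truncE n k : (x - \sum_(k < n) x k *: ell2_basis R k) k = if (k < n)%N then 0 else x k.
  have -> : (x - \sum_(k < n) x k *: ell2_basis R k) k =
      x k - (\sum_(j < n) x j *: ell2_basis R j) k by [].
  rewrite ell2_sum_fun.
  have termE (j : 'I_n) : (x j *: ell2_basis R j) k = x j * (k == j)%:R by [].
  under eq_bigr do rewrite termE.
  case: ltnP => [kn|nk].
    rewrite (bigD1 (Ordinal kn))//= eqxx mulr1 big1 ?addr0 ?subrr// => j.
    by rewrite -val_eqE /= eq_sym => /negPf->; rewrite mulr0.
  rewrite big1 ?subr0// => j _.
  by rewrite gtn_eqF ?mulr0// (leq_trans _ nk).
apply/cvgrPdist_lt => e egt0; have /Re_gt0[eE e0] := egt0.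
have e20 : 0 < (complex.Re e) ^+ 2 / 2 by rewrite divr_gt0// exprn_gt0.
have /cvgrPdist_lt/(_ _ e20) := sq_cvg; apply: filterS => n Sn.
set y := x - _.
have : `|y| ^+ 2 <= (limn S - S n)%:C%C.
  rewrite ell2_normE; apply: ell2_dot_le => m.
  have -> : series (fun k => `|y k| ^+ 2) m =
      (\sum_(0 <= k < m) if (k < n)%N then 0 else complex.Re `|x k| ^+ 2)%:C%C.
    rewrite rmorph_sum; apply: eq_bigr => k _; rewrite truncE.
    by case: ifP => _; rewrite ?normr0 ?expr0n// (Re_normE (x k)) rmorphXn.
  rewrite lecR lerBrDr; apply: (@le_trans _ _ (S (maxn m n))); last first.
    by apply: nondecreasing_cvgn_le => //; apply: nondecreasing_series => k _ _; exact: sqr_ge0.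
  rewrite /S /series /= (big_cat_nat (n := n) (leq0n _) (leq_maxr m n)) /= [leRHS]addrC lerD2r.
  have [mn|nm] := leqP m n.
    rewrite big_nat_cond big1 ?sumr_ge0// => [k _|k /andP[/andP[_ km] _]].
      exact: sqr_ge0.
    by rewrite (leq_trans km).
  rewrite (big_cat_nat (n := n) (leq0n _) (ltnW nm)) /= big_nat_cond big1 ?add0r; last first.
    by move=> k /andP[/andP[_ ->]].
  by apply: ler_sum_nat => k /andP[nk _]; rewrite ltnNge nk.
move=> yle; rewrite -ltr_sqr ?nnegrE ?normr_ge0 ?(ltW egt0)//.
apply: (le_lt_trans yle); rewrite eE -rmorphXn /= ltcR.
apply: (le_lt_trans (ler_norm _)); apply: (lt_le_trans Sn).
by rewrite ler_pdivrMr// ler_peMr ?ler1n// sqr_ge0.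
Qed.

(** Truncations converge, so the basis vectors span a dense subspace. Linearity is a premise on bare
    functions, so that composites need no packing. *)
Lemma ell2_linear_ext (V : normedModType R[i]) (f g : ell2 R -> V) :
  linear f -> linear g -> continuous f -> continuous g ->
  (forall n, f (ell2_basis R n) = g (ell2_basis R n)) -> f =1 g.
Proof.
move=> fl gl fc gc fg x.
have lin0 (h : ell2 R -> V) : linear h -> h 0 = 0.
  by move=> hl; have := hl (-1) 0 0; rewrite scaler0 addr0 scaleN1r addNr.
have linS (h : ell2 R -> V) n : linear h ->
    h (\sum_(k < n) x k *: ell2_basis R k) = \sum_(k < n) x k *: h (ell2_basis R k).
  move=> hl; elim: n => [|n IH]; first by rewrite !big_ord0 lin0.
  by rewrite !big_ord_recr /= addrC hl IH addrC.
have fx := cvg_comp _ _ (@ell2_trunc_cvg x) (@fc x).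
have gx := cvg_comp _ _ (@ell2_trunc_cvg x) (@gc x).
apply: (@cvg_unique _ (@norm_hausdorff _ V) _ _ _ _ fx).
rewrite (_ : f \o _ = g \o (fun n => \sum_(k < n) x k *: ell2_basis R k))//.
by apply/funext => n /=; rewrite !linS//; apply: eq_bigr => k _; rewrite fg.
Qed.

End ell2_density.

(** * Bounded linear maps, inner products and isometries *)

Section bounded_linear.
Variable R : realType.

Lemma bounded_near_le (V W : normedModType R[i]) (f : {linear V -> W}) (M : R) :
  (forall x, `|f x| <= M%:C%C * `|x|) -> bounded_near f (nbhs 0).
Proof.
move=> fM; apply/linear_boundedP; exists M%:C%C; split=> [|r Mr x].
  by apply/complex_realP; exists M.
by apply: (le_trans (fM x)); rewrite ler_wpM2r// ltW.
Qed.

Lemma linear_continuous_le (V W : normedModType R[i]) (f : V -> W) (M : R) :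
  linear f -> (forall x, `|f x| <= M%:C%C * `|x|) -> continuous f.
Proof.
move=> fl fM.
pose g : {linear V -> W} := HB.pack f (GRing.isLinear.Build R[i] V W _ f fl).
by apply: (@bounded_linear_continuous _ _ _ g); exact: (@bounded_near_le _ _ g M).
Qed.

Lemma inner_CauchySchwarz (H : preHilbertType R) (x y : H) :
  `|inner x y| <= `|x| * `|y|.
Proof.
have := dot_CauchySchwarz (@inner R H) x y.
by rewrite /dot_norm !inner_norm !sqrCK.
Qed.

Lemma inner_linear (H : preHilbertType R) (y : H) :
  linear ((fun x => inner x y) : H -> R[i]).
Proof. by move=> a x z; rewrite linearDl linearZl_LR. Qed.

Lemma inner_continuous (H : preHilbertType R) (y : H) :
  continuous ((fun x => inner x y) : H -> R[i]).
Proof.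
apply: (@linear_continuous_le _ _ _ (complex.Re `|y|)); first exact: inner_linear.
by move=> x; rewrite -Re_normE mulrC; exact: inner_CauchySchwarz.
Qed.

(** Choose preimages [g] on the range. For y in the closure, the isometry turns the trace on the
    range of the neighbourhoods of y into a Cauchy filter; its limit x exists by completeness, and f
    x = y by uniqueness of limits. *)
Lemma isometry_range_closed (V W : completeNormedModType R[i]) (f : V -> W) :
  linear f -> (forall x, `|f x| = `|x|) -> closed (range f).
Proof.
move=> fl fn y yf.
have fB u v : f (u - v) = f u - f v.
  by rewrite addrC -[in LHS]scaleN1r fl scaleN1r addrC.
have [g fg] : exists g : W -> V, forall z, range f z -> f (g z) = z.
  exists (fun z => if pselect (range f z) is left p then sval (cid2 p) else 0) => z fz.
  by case: pselect => // p; case: cid2.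
pose G := within (range f) (nbhs y).
have GG : ProperFilter G.
  by apply: within_nbhs_proper.
have gc : cauchy (g @ G).
  apply/cauchy_ballP => e e0.
  have e20 : 0 < e / 2 by rewrite divr_gt0.
  exists (g @` (range f `&` ball y (e / 2)), g @` (range f `&` ball y (e / 2))) => /=.
    have h : G (g @^-1` (g @` (range f `&` ball y (e / 2)))).
      rewrite /G /within /=; near=> z => fz; exists z => //; split => //.
      by near: z; exact: nbhsx_ballx.
    by split.
  case=> _ _ [[u [fu yu] <-] [v [fv yv] <-]] /=.
  move: yu yv; rewrite -!ball_normE /= => yu yv; rewrite -fn fB !fg//.
  rewrite (le_lt_trans (ler_distD y u v))// [ltRHS]splitr ltrD//.
  by rewrite distrC.
have /cvg_ex[/= x gx] : cvg (g @ G) by apply: cauchy_cvg.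
have fc : continuous f by apply: (@linear_continuous_le _ _ f 1) => // z; rewrite fn mul1r.
have fx : f @ (g @ G) --> f x by apply: (cvg_comp _ _ gx (@fc x)).
have fy : f @ (g @ G) --> y.
  move=> A yA; rewrite -[X in X A]/(fun B => nbhs y [set z | range f z -> B (f (g z))]).
  by apply: filterS yA => z Az fz; rewrite fg.
exists x => //.
by apply: (@cvg_unique _ (@norm_hausdorff _ W) _ _ _ _ fx fy).
Unshelve. all: by end_near. Qed.

End bounded_linear.

Section ell2_operators.
Variable R : realType.
Implicit Types (x y : ell2 R).

Lemma inner_ell2_basis n y : inner (ell2_basis R n) y = Num.conj (y n).
Proof.
rewrite ell2_innerE; apply: ell2_dot_eq; apply: cvg_near_cst.
near=> m; rewrite /series /= big_mkord.
have nm : (n < m)%N by near: m; exact: nbhs_infty_gt.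
rewrite (bigD1 (Ordinal nm))//= [X in X * _]/(_ == _)%:R eqxx mul1r.
rewrite big1 ?addr0// => i; rewrite -val_eqE /= => /negPf iE.
by rewrite [X in X * _](_ : _ = (i == n :> nat)%:R)// iE mul0r.
Unshelve. all: by end_near. Qed.

Lemma inner_ell2C x y : inner x y = Num.conj (inner y x).
Proof. exact: ell2_dot_conj. Qed.

(** Arbitrary finite index sets are needed because an injective change of index does not preserve
    initial segments. *)
Lemma ell2_sum_uniq_le x (s : seq nat) : uniq s ->
  \sum_(k <- s) `|x k| ^+ 2 <= `|x| ^+ 2.
Proof.
move=> us; pose N := (\max_(k <- s) k).+1.
apply: (@le_trans _ _ (\sum_(0 <= k < N) `|x k| ^+ 2)); last first.
  by rewrite ell2_normE; exact: ell2_partial_le.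
rewrite (perm_big [seq k <- index_iota 0 N | k \in s]); last first.
  apply: uniq_perm => [//||k]; first by rewrite filter_uniq// iota_uniq.
  rewrite mem_filter mem_index_iota /= /N ltnS.
  by case: (boolP (k \in s)) => //= ks; rewrite (@leq_bigmax_seq _ s xpredT id).
rewrite big_filter [leRHS](bigID (mem s)) /= lerDl; apply: sumr_ge0 => k _; exact: exprn_ge0.
Qed.

Section weighted_composition.
Variables (w : nat -> R) (sigma : nat -> nat).
Hypothesis w_le1 : forall n, `|w n| <= 1.
Hypothesis sigma_inj : injective sigma.

(** The raising and lowering halves of the Jacobi operator both have this form. *)
Definition wcomp_fun (x : nat -> R[i]) n : R[i] := (w n)%:C%C * x (sigma n).

Lemma wcomp_fun_le x n : series (fun k => `|wcomp_fun x k| ^+ 2) n <= `|x| ^+ 2.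
Proof.
have sigma_uniq : uniq (map sigma (index_iota 0 n)).
  by rewrite map_inj_uniq// iota_uniq.
apply: le_trans (ell2_sum_uniq_le x sigma_uniq); rewrite big_map /series /=.
apply: ler_sum => k _; rewrite normrM exprMn ler_piMl ?exprn_ge0//.
by rewrite exprn_ile1// norm_realC lecR.
Qed.

Definition wcomp x : ell2 R := Ell2 (square_summable_le (wcomp_fun_le x)).

Lemma wcomp_linear : linear wcomp.
Proof.
move=> a x y; apply/val_inj/funext => n.
rewrite -[LHS]/((w n)%:C%C * (a * x (sigma n) + y (sigma n))).
rewrite -[RHS]/(a * ((w n)%:C%C * x (sigma n)) + (w n)%:C%C * y (sigma n)).
by ring.
Qed.

Lemma wcomp_norm_le x : `|wcomp x| <= `|x|.
Proof.
rewrite -ler_sqr ?nnegrE// ell2_normE; apply: ell2_dot_le => n.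
exact: wcomp_fun_le.
Qed.

End weighted_composition.

(* The u k have disjoint supports, kappa n being the only index k such that
   u k n can be nonzero; hence \sum_k x_k u_k can be defined coordinatewise. *)
Section isometry.
Variables (u : nat -> ell2 R) (kappa : nat -> nat).
Hypothesis u_orthonormal : forall k l, inner (u k) (u l) = (k == l)%:R.
Hypothesis u_supp : forall k n, u k n != 0 -> kappa n = k.

Definition fiber_isometry_fun (x : nat -> R[i]) n : R[i] := x (kappa n) * u (kappa n) n.

Lemma fiber_isometry_fun_le x n :
  series (fun k => `|fiber_isometry_fun x k| ^+ 2) n <= `|x| ^+ 2.
Proof.
pose K := (\max_(i < n) kappa i).+1.
apply: (@le_trans _ _ (\sum_(0 <= k < K) `|x k| ^+ 2)); last first.
  by rewrite ell2_normE; exact: ell2_partial_le.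
rewrite /series /= !big_mkord.
have -> : \sum_(i < n) `|fiber_isometry_fun x i| ^+ 2 =
    \sum_(i < n) \sum_(k < K) `|x k| ^+ 2 * `|u k i| ^+ 2.
  apply: eq_bigr => i _.
  have iK : (kappa i < K)%N by rewrite ltnS; exact: (leq_bigmax i).
  rewrite (bigD1 (Ordinal iK))//= big1 ?addr0 => [|k ki].
    by rewrite normrM exprMn.
  have [->|/u_supp kE] := eqVneq (u k i) 0; first by rewrite normr0 expr0n mulr0.
  by move: ki; rewrite -val_eqE /= kE eqxx.
rewrite exchange_big /=; apply: ler_sum => k _.
rewrite -mulr_sumr ler_piMr ?exprn_ge0//.
have := ell2_partial_le (u k) n; rewrite /series /= big_mkord => /le_trans; apply.
by rewrite -[ell2_dot _ _]/(inner _ _) u_orthonormal eqxx.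
Qed.

Definition fiber_isometry x : ell2 R := Ell2 (square_summable_le (fiber_isometry_fun_le x)).

Lemma fiber_isometry_linear : linear fiber_isometry.
Proof.
move=> a x y; apply/val_inj/funext => n.
rewrite -[LHS]/((a * x (kappa n) + y (kappa n)) * u (kappa n) n).
rewrite -[RHS]/(a * (x (kappa n) * u (kappa n) n) + y (kappa n) * u (kappa n) n).
by ring.
Qed.

Lemma fiber_isometry_continuous : continuous fiber_isometry.
Proof.
apply: (@linear_continuous_le _ _ _ _ 1); first exact: fiber_isometry_linear.
move=> x; rewrite mul1r -ler_sqr ?nnegrE// ell2_normE; apply: ell2_dot_le => n.
exact: fiber_isometry_fun_le.
Qed.

Lemma fiber_isometry_basis k : fiber_isometry (ell2_basis R k) = u k.
Proof.
apply/val_inj/funext => n.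
rewrite -[LHS]/((kappa n == k)%:R * u (kappa n) n) -[RHS]/(u k n).
have [->|kn] := eqVneq; first by rewrite mul1r.
rewrite mul0r; have [->//|/u_supp kE] := eqVneq (u k n) 0.
by rewrite kE eqxx in kn.
Qed.

Lemma fiber_isometry_inner x y :
  inner (fiber_isometry x) (fiber_isometry y) = inner x y.
Proof.
have lin (z : ell2 R) : linear ((fun x => inner (fiber_isometry x) z) : ell2 R -> R[i]).
  by move=> a x1 x2; rewrite fiber_isometry_linear inner_linear.
have cont (z : ell2 R) : continuous ((fun x => inner (fiber_isometry x) z) : ell2 R -> R[i]).
  move=> x0; apply: (@continuous_comp _ _ _ fiber_isometry (fun x => inner x z : R[i])).
    exact: fiber_isometry_continuous.
  exact: inner_continuous.
move: x; apply: ell2_linear_ext => //; [exact: inner_linear|exact: inner_continuous|].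
(* [ell2_linear_ext] works in the first, linear argument; conjugate symmetry brings y there. *)
move=> k; rewrite inner_ell2C [RHS]inner_ell2C; congr (Num.conj _).
move: y; apply: ell2_linear_ext => //; [exact: inner_linear|exact: inner_continuous|].
move=> l; rewrite !fiber_isometry_basis u_orthonormal inner_ell2_basis.
by rewrite ell2_basisE conjC_nat.
Qed.

End isometry.

End ell2_operators.

(** [ell2] is indexed by [nat], so l^2(Z x Z) is realised through an enumeration of the pairs. *)
Lemma int2_nat_bij : exists (e : int * int -> nat) (d : nat -> int * int),
  cancel e d /\ cancel d e.
Proof.
have inf : infinite_set [set: int * int].
  move=> fin; apply: infinite_nat.
  rewrite -(preimage_setT (fun n : nat => (Posz n, 0 : int))).
  by apply: finite_preimage fin => n m _ _ [].
have /card_set_bijP[e] : ([set: int * int] #= [set: nat])%card.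
  by apply: eq_card_nat => //; exact: countableP.
rewrite setTT_bijective => -[d eK dK].
by exists e, d.
Qed.

(** * The normal extension *)

Section jacobi_shift.
Variables (R : realType) (b : int -> R).
Variables (e : int * int -> nat) (d : nat -> int * int).
Hypotheses (eK : cancel e d) (dK : cancel d e).
Hypothesis b_le1 : forall j, `|b j| <= 1.
Implicit Types (s : int) (x y : ell2 R).

Let move_index s r n : nat := e ((d n).1 + s, (d n).2 + r).

Let move_index_inj s r : injective (move_index s r).
Proof.
move=> n m /(can_inj eK)[/addIr h1 /addIr h2]; apply: (can_inj dK).
by rewrite (surjective_pairing (d n)) h1 h2 -surjective_pairing.
Qed.

Let down_le1 n : `|b ((d n).2 - 1)| <= 1. Proof. exact: b_le1. Qed.

Let up_le1 n : `|b (d n).2| <= 1. Proof. exact: b_le1. Qed.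

(* Reading coordinates in Z x Z through e and d, this is (shift by -s) (x) A. *)
Definition jacobi_shift s x : ell2 R :=
  wcomp down_le1 (@move_index_inj s (-1)) x + wcomp up_le1 (@move_index_inj s 1) x.

Lemma jacobi_shiftE s x n : jacobi_shift s x n =
  (b ((d n).2 - 1))%:C%C * x (e ((d n).1 + s, (d n).2 - 1)) +
  (b (d n).2)%:C%C * x (e ((d n).1 + s, (d n).2 + 1)).
Proof. by []. Qed.

Lemma jacobi_shift_linear s : linear (jacobi_shift s).
Proof.
move=> a x y; rewrite /jacobi_shift !wcomp_linear scalerDr.
by rewrite addrACA.
Qed.

HB.instance Definition _ s := GRing.isLinear.Build R[i] (ell2 R) (ell2 R) _
  (jacobi_shift s) (jacobi_shift_linear s).

Lemma jacobi_shift_le s x : `|jacobi_shift s x| <= 2%:C%C * `|x|.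
Proof.
rewrite (le_trans (ler_normD _ _))// rmorph_nat mulr_natl mulr2n lerD//; exact: wcomp_norm_le.
Qed.

Lemma jacobi_shift_continuous s : continuous (jacobi_shift s).
Proof.
by apply: (@linear_continuous_le _ _ _ _ 2);
  [exact: jacobi_shift_linear|exact: jacobi_shift_le].
Qed.

Lemma jacobi_shift_bounded s : bounded_near (jacobi_shift s) (nbhs 0).
Proof. exact: (@bounded_near_le _ _ _ (jacobi_shift s) 2 (@jacobi_shift_le s)). Qed.

(** The opposite translations cancel, and both sides act as A^2 in the second index. *)
Lemma jacobi_shift_comm s x :
  jacobi_shift s (jacobi_shift (- s) x) = jacobi_shift (- s) (jacobi_shift s x).
Proof.
apply/val_inj/funext => n; rewrite -[LHS]/(jacobi_shift _ _ n) -[RHS]/(jacobi_shift _ _ n).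
by rewrite !jacobi_shiftE !eK /= !addrK !subrK.
Qed.

Lemma jacobi_shift_basis s k j : jacobi_shift s (ell2_basis R (e (k, j))) =
  (b j)%:C%C *: ell2_basis R (e (k - s, j + 1)) +
  (b (j - 1))%:C%C *: ell2_basis R (e (k - s, j - 1)).
Proof.
apply/val_inj/funext => n; rewrite -[LHS]/(jacobi_shift _ _ n) jacobi_shiftE.
rewrite -[RHS]/((b j)%:C%C * ell2_basis R (e (k - s, j + 1)) n +
  (b (j - 1))%:C%C * ell2_basis R (e (k - s, j - 1)) n).
rewrite !ell2_basisE -(dK n) eK !(inj_eq (can_inj eK)) -!pair_eqE /pair_eq /=.
case: (d n) => k' j' /=.
rewrite ![_ + s == k]eq_sym -!subr_eq ![k - s == _]eq_sym subr_eq.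
rewrite [j' + 1 == j]eq_sym -[j == j' + 1]subr_eq [j - 1 == _]eq_sym.
congr (_ + _).
  by have [->|] := eqVneq (j' - 1) j; rewrite ?andbF ?mulr0.
by have [->|] := eqVneq j' (j - 1); rewrite ?andbF ?mulr0.
Qed.

(** A is real symmetric and the adjoint of a translation is the opposite one; by density, basis
    vectors suffice. *)
Lemma jacobi_shift_adjoint s : is_adjoint (jacobi_shift s) (jacobi_shift (- s)).
Proof.
move=> x y; move: x.
apply: (@ell2_linear_ext _ _ (fun x => inner (jacobi_shift s x) y : R[i])
    (fun x => inner x (jacobi_shift (- s) y) : R[i])).
- by move=> a x1 x2; rewrite jacobi_shift_linear inner_linear.
- exact: inner_linear.
- move=> x; apply: (@continuous_comp _ _ _ (jacobi_shift s) (fun x => inner x y : R[i])).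
    exact: jacobi_shift_continuous.
  exact: inner_continuous.
- exact: inner_continuous.
- move=> n; rewrite -(dK n); case: (d n) => k j.
  rewrite jacobi_shift_basis linearDl !linearZl_LR /= !inner_ell2_basis.
  rewrite jacobi_shiftE eK /= rmorphD !rmorphM /= !conj_realC.
  by rewrite addrC.
Qed.

Lemma jacobi_shift_normal s : normal_op (jacobi_shift s).
Proof.
split; first exact: jacobi_shift_bounded.
exists (jacobi_shift (- s)); split.
- exact: jacobi_shift_bounded.
- exact: jacobi_shift_adjoint.
- exact: jacobi_shift_comm.
Qed.

(* v k is A^k applied to the basis vector at 1. *)
Section orbit.
Variable v : nat -> int -> R.
Hypothesis v0 : forall j, v 0%N j = (j == 1)%:R.
Hypothesis vS : forall k j,
  v k.+1 j = b (j - 1) * v k (j - 1) + b j * v k (j + 1).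

(** The first index counts the steps, so the orbit vectors lie on distinct layers. The layer c and
    the stage m are arbitrary because [iter_cyclic_vec_inner] moves an already shifted vector
    back. *)
Lemma jacobi_shift_layer s c m x :
  (forall n, x n = if (d n).1 == c then (v m (d n).2)%:C%C else 0) ->
  forall n, jacobi_shift s x n =
    if (d n).1 == c - s then (v m.+1 (d n).2)%:C%C else 0.
Proof.
have layerE i : (i + s == c) = (i == c - s) by rewrite eq_sym -subr_eq eq_sym.
move=> xE n; rewrite jacobi_shiftE !xE !eK /= layerE.
by case: eqP => _; rewrite ?mulr0 ?addr0// vS rmorphD !rmorphM.
Qed.

Lemma iter_jacobi_shift_layer s c m k x :
  (forall n, x n = if (d n).1 == c then (v m (d n).2)%:C%C else 0) ->
  forall n, iter k (jacobi_shift s) x n =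
    if (d n).1 == c - s *+ k then (v (m + k)%N (d n).2)%:C%C else 0.
Proof.
move=> xE; elim: k => [|k IH] n; first by rewrite mulr0n subr0 addn0.
by rewrite iterS (jacobi_shift_layer _ IH) -addrA -opprD mulrSr addnS.
Qed.

Lemma iter_jacobi_shift_adjoint s k x y :
  inner (iter k (jacobi_shift s) x) y = inner x (iter k (jacobi_shift (- s)) y).
Proof.
elim: k y => [//|k IH] y.
by rewrite iterS jacobi_shift_adjoint IH -iterSr.
Qed.

Definition cyclic_vec : ell2 R := ell2_basis R (e (0, 1)).

Lemma cyclic_vecE n :
  cyclic_vec n = if (d n).1 == 0 then (v 0%N (d n).2)%:C%C else 0.
Proof.
rewrite ell2_basisE -{1}(dK n) (inj_eq (can_inj eK)) v0.
case: (d n) => k j /=; rewrite -pair_eqE /pair_eq /=.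
by case: eqP => // _; rewrite rmorph_nat.
Qed.

Lemma iter_cyclic_vecE k n : iter k (jacobi_shift (-1)) cyclic_vec n =
  if (d n).1 == k then (v k (d n).2)%:C%C else 0.
Proof.
rewrite (iter_jacobi_shift_layer _ _ cyclic_vecE) add0n sub0r.
by rewrite mulNrn opprK natz.
Qed.

(** Moving the k iterations to the right yields a vector on layer l - k with profile [v (l + k)],
    read at the index (0, 1). *)
Lemma iter_cyclic_vec_inner k l :
  inner (iter k (jacobi_shift (-1)) cyclic_vec) (iter l (jacobi_shift (-1)) cyclic_vec) =
  (if k == l then v k.*2 1 else 0)%:C%C.
Proof.
rewrite iter_jacobi_shift_adjoint inner_ell2_basis.
rewrite (iter_jacobi_shift_layer _ _ (iter_cyclic_vecE l)) eK /= opprK.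
rewrite eq_sym subr_eq0 natz eqz_nat eq_sym.
case: eqP => [->|_]; last by rewrite conjC0.
by rewrite conj_realC addnn.
Qed.

End orbit.

End jacobi_shift.

(** * The weighted shift as a restriction of the normal operator *)

Section weighted_shift.
Variables (R : realType) (alpha : nat -> R).
Hypothesis alpha_gt0 : forall n, 0 < alpha n.

Lemma moment_gt0 n : 0 < moment alpha n.
Proof. by apply: prodr_gt0 => j _; rewrite exprn_gt0. Qed.

Lemma momentS n : moment alpha n.+1 = moment alpha n * alpha n ^+ 2.
Proof. by rewrite /moment big_ord_recr. Qed.

Hypothesis alpha_bounded : bounded_fun alpha.

Lemma ell2_basis_norm n : `|ell2_basis R n| = 1.
Proof.
apply/eqP; rewrite -(@eqrXn2 _ 2)// expr1n -inner_norm inner_ell2_basis.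
by rewrite ell2_basisE eqxx conjC1.
Qed.

Lemma weight_le_opnorm n : ((alpha n)%:E <= opnorm (wshift alpha_bounded))%E.
Proof.
apply: ereal_sup_ubound; exists (ell2_basis R n); first by rewrite /= ell2_basis_norm.
congr (_%:E); rewrite wshift_basis normrZ ell2_basis_norm mulr1 norm_realC /=.
by rewrite gtr0_norm.
Qed.

Lemma wshift_continuous : continuous (wshift alpha_bounded).
Proof.
exact: (@bounded_linear_continuous _ _ _ (wshift alpha_bounded) (wshift_bounded _)).
Qed.

Lemma subnormal_wshift :
  (forall i p, 0 <= moment_functional (moment alpha) ('X^i * (p * p))) ->
  (forall i p, 0 <= moment_functional (moment alpha) ('X^i * ((1 - 'X) * (p * p)))) ->
  subnormal (wshift alpha_bounded).
Proof.
move=> psd psd1.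
have moment0 : moment alpha 0 = 1 by rewrite /moment big_ord0.
have [b [v [b_le1 v0 vS vE]]] := jacobi_recurrence moment0 psd psd1.
have [e [d [eK dK]]] := int2_nat_bij.
pose N : {linear ell2 R -> ell2 R} := jacobi_shift eK dK b_le1 (-1).
pose xi := cyclic_vec R e.
(* [moment alpha k] is the square norm of N^k xi, so [u] is the normalised orbit. *)
pose c k : R := (Num.sqrt (moment alpha k))^-1.
pose u k : ell2 R := (c k)%:C%C *: iter k N xi.
have sqrt_gt0 k : 0 < Num.sqrt (moment alpha k) by rewrite sqrtr_gt0 moment_gt0.
have u_orthonormal k l : inner (u k) (u l) = (k == l)%:R.
  rewrite linearZl_LR linearZr_LR /= (iter_cyclic_vec_inner eK dK b_le1 v0 vS).
  rewrite conj_realC -!rmorphM /=.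
  case: eqP => [<-|_]; last by rewrite !mulr0 rmorph0.
  rewrite vE -(@sqr_sqrtr _ (moment alpha k)) ?ltW ?moment_gt0//.
  by rewrite (_ : _ * _ = 1) ?rmorph1// /c; field; rewrite gt_eqF.
have uE k n : u k n = (c k)%:C%C * iter k N xi n by [].
(* [u k] lives on layer k, so the index is recovered as the absolute value of the first coordinate;
   on negative layers every [u k] vanishes. *)
have u_supp k n : u k n != 0 -> absz (d n).1 = k.
  rewrite uE (iter_cyclic_vecE eK dK b_le1 v0 vS).
  by have [->|_] := eqVneq (d n).1 (Posz k); rewrite ?mulr0 ?eqxx.
pose U := fiber_isometry u_orthonormal u_supp.
have U_inner := fiber_isometry_inner u_orthonormal u_supp.
have U_linear : linear U by exact: fiber_isometry_linear.
have U_cont : continuous U by exact: fiber_isometry_continuous.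
have UE k : U (ell2_basis R k) = u k by exact: fiber_isometry_basis.
have intertwine x : U (wshift alpha_bounded x) = N (U x).
  move: x; apply: (@ell2_linear_ext _ _ (U \o wshift alpha_bounded) (N \o U)).
  - by move=> a x y; rewrite /= wshift_is_linear U_linear.
  - by move=> a x y; rewrite /= U_linear /N jacobi_shift_linear.
  - by move=> x; apply: continuous_comp; [exact: wshift_continuous|exact: U_cont].
  - by move=> x; apply: continuous_comp; [exact: U_cont|exact: jacobi_shift_continuous].
  move=> k; rewrite /= wshift_basis.
  have -> : U ((alpha k)%:C%C *: ell2_basis R k.+1) = (alpha k)%:C%C *: u k.+1.
    have U0 : U 0 = 0 by have := U_linear (-1) 0 0; rewrite scaler0 addr0 scaleN1r addNr.
    by have := U_linear (alpha k)%:C%C (ell2_basis R k.+1) 0; rewrite U0 !addr0 UE.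
  have -> : N (U (ell2_basis R k)) = (c k)%:C%C *: iter k.+1 N xi by rewrite UE /u linearZ.
  rewrite /u scalerA -rmorphM (_ : alpha k * c k.+1 = c k)//.
  rewrite /c momentS sqrtrM ?(ltW (moment_gt0 _))// sqrtr_sqr gtr0_norm//.
  by field; rewrite !gt_eqF.
pose Ul : {linear ell2 R -> ell2 R} :=
  HB.pack U (GRing.isLinear.Build R[i] (ell2 R) (ell2 R) _ U U_linear).
exists (ell2 R), N, (range U); split.
- exact: jacobi_shift_normal.
- split.
  + by exists 0 => //; exact: (linear0 Ul).
  + move=> a _ _ [x _ <-] [y _ <-]; exists (a *: x + y) => //; exact: U_linear.
  + apply: isometry_range_closed => // x; apply/eqP.
    by rewrite -(@eqrXn2 _ 2)// -!inner_norm U_inner.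
- by move=> _ [_ [x _ <-] <-]; exists (wshift alpha_bounded x).
- by exists Ul; split.
Qed.

End weighted_shift.

Theorem theorem1p3 (R : realType) (alpha : nat -> R)
    (alpha_gt0 : forall n, 0 < alpha n)
    (alpha_bounded : bounded_fun alpha)
    (contractive : (opnorm (wshift alpha_bounded) <= 1)%E)
    (alpha_cvg : cvgn alpha)
    (m : nat)
    (alpha_PD_or_CPD : forall k, (1 <= k)%N -> (m <= k)%N ->
       shift_PD alpha k m \/ shift_CPD alpha k m) :
  subnormal (wshift alpha_bounded).
Proof.
have alpha_le1 n : alpha n <= 1.
  by rewrite -lee_fin (le_trans (weight_le_opnorm alpha_gt0 alpha_bounded n)).
have moment_ge0 n : 0 <= moment alpha n by exact/ltW/moment_gt0.
have /cvg_ex[/= g moment_cvg] : cvgn (moment alpha).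
  apply: nonincreasing_is_cvgn; last by exists 0 => _ [n _ <-].
  apply/nonincreasing_seqP => n; rewrite momentS ler_piMr// exprn_ile1//.
  exact/ltW.
have g_ge0 : 0 <= g by apply: cvgr_to_ge moment_cvg _; exact: nearW.
have cpd i q : q.[1] = 0 ->
    0 <= moment_functional (moment alpha) ('X^i * ((1 - 'X) ^+ (2 * m) * (q * q))).
  move=> q1.
  (* This k is at least 1 and makes the matrix large enough to hold all coefficients of q. Either
     alternative gives CPD, as PD implies it. *)
  have cpd_k : shift_CPD alpha (m + (size q).+1) m.
    have k_ge1 : (1 <= m + (size q).+1)%N by rewrite addnS.
    have [pd|//] := alpha_PD_or_CPD _ k_ge1 (leq_addr _ _).
    by move=> j; have [herm pos] := pd j; split.
  have := cond_posdef_moment_functional (cpd_k i).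
  rewrite addKn => /(_ q (leqW (leqnSn _)) q1).
  by rewrite moment_functional_iter_nabla; congr (_ <= moment_functional _ _); ring.
(* Taking q = (1 - X) p meets the constraint at 1 for every p, at the cost of two more factors 1 -
   X. *)
have psd2 i p :
    0 <= moment_functional (moment alpha) ('X^i * ((1 - 'X) ^+ (2 * m).+2 * (p * p))).
  rewrite (_ : (1 - 'X) ^+ _ * _ =
    (1 - 'X) ^+ (2 * m) * ((1 - 'X) * p * ((1 - 'X) * p))); last by rewrite !exprS; ring.
  by apply: cpd; rewrite hornerM hornerD hornerN hornerX hornerC subrr mul0r.
apply: subnormal_wshift => // i p.
  apply: (moment_functional_iter_descent (n := (2 * m).+2) moment_cvg) => //.
  by rewrite hornerM -expr2 sqr_ge0.
(* One of the 2m + 2 factors is kept in the target (1 - X) p^2, whose value at 1 is 0. *)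
apply: (moment_functional_iter_descent (n := (2 * m).+1) moment_cvg) => //.
  by rewrite hornerM hornerD hornerN hornerX hornerC subrr mul0r.
by move=> j; rewrite mulrA -exprSr.
Qed.
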